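(* Let $P$ be a Markovian kernel on a measurable space $(E,\mathcal{B})$, $S_n=\frac1n\sum_{k=0}^{n-1}P^k$, $R=\sum_{k=0}^\infty2^{-(k+1)}P^k$, and $\mathcal{B}_1^+$ the set of measurable $f$ with $0\le f\le1$. Assume Assumption C: (i) there exist $C\in\mathcal{B}$, $\phi:\mathcal{B}_1^+\to\mathbb{R}_+$ and $\gamma:E\to\mathbb{R}_+$ such that $Pf(x)\le\phi(f)+\gamma(x)$ for all $x\in C$ and $f\in\mathcal{B}_1^+$; (ii) there exists a finite positive measure $m$ on $E$ such that (ii.1) $\lim_{m\circ R(A)\to0}\phi(R1_A)=0$, and (ii.2) there exists $n_0>0$ with $\sup_{n\ge n_0}m(S_n(1_C(\gamma-1)))<0$. Then the measure $m\circ R$ is mean almost invariant for $P$.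
   Context: $m\circ R$ denotes the measure $A\mapsto m(R1_A)$. A finite positive measure $\mu$ is mean almost invariant for $P$ if there exist $\delta\in[0,1)$, a set function $\psi:\mathcal{B}\to\mathbb{R}_+$ with $\lim_{\mu(A)\to0}\psi(A)=0$, and $n_1$ such that $\mu(S_n1_A)\le\psi(A)+\delta\mu(E)$ for all $A\in\mathcal{B}$ and $n\ge n_1$. *)

(* Defs.v *)
From HB Require Import structures.
From mathcomp Require Import all_boot all_order all_algebra.
From mathcomp Require Import all_classical all_reals all_analysis.
From mathcomp Require Import measurable_realfun.
Set Implicit Arguments. Unset Strict Implicit. Unset Printing Implicit Defensive.
Import Order.TTheory GRing.Theory Num.Theory.
Local Open Scope classical_set_scope.
Local Open Scope ring_scope.
Local Open Scope ereal_scope.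

Section Defs.
Context {d : measure_display} {T : measurableType d} {R : realType}.
Variable P : R.-pker T ~> T.

Definition Pop (f : T -> \bar R) : T -> \bar R := fun x => \int[P x]_y f y.

Fixpoint Ppow (k : nat) (f : T -> \bar R) : T -> \bar R :=
  match k with O => f | S k' => Pop (Ppow k' f) end.

Definition Smean (n : nat) (f : T -> \bar R) : T -> \bar R :=
  fun x => ((n%:R)^-1)%:E * \sum_(k < n) Ppow k f x.

Definition Rres (f : T -> \bar R) : T -> \bar R :=
  fun x => \sum_(0 <= k <oo) (((2 ^+ k.+1)^-1 : R)%:E * Ppow k f x).

Definition ind (A : set T) : T -> \bar R := fun x => (\1_A x)%:E.

Definition B1plus (f : T -> \bar R) : Prop :=
  measurable_fun setT f /\ (forall x, 0 <= f x <= 1).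

Definition mR (m : set T -> \bar R) (A : set T) : \bar R :=
  \int[m]_x Rres (ind A) x.

Definition mean_almost_invariant (mu : {measure set T -> \bar R}) : Prop :=
  mu setT < +oo /\
  exists (delta : R) (psi : set T -> R) (n1 : nat),
    (0 <= delta < 1)%R /\
    (forall A, measurable A -> (0 <= psi A)%R) /\
    (forall eps : R, (0 < eps)%R -> exists eta : R, (0 < eta)%R /\
       forall A, measurable A -> mu A < eta%:E -> (psi A < eps)%R) /\
    (forall A, measurable A -> forall n, (n1 <= n)%N ->
       \int[mu]_x Smean n (ind A) x <= (psi A)%:E + delta%:E * mu setT).
End Defs.

(* Main.v *)
(* Write f = R 1_A and g = 1_C (gamma - 1). Comparing Pf with 1 off C and with
   Assumption C(i) on C gives Pf <= 1 + phi(f) + g everywhere, so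
   m(S_n P f) <= (1 + phi(f)) m(E) + m(S_n g), where m(S_n g) <= -c < 0 for
   large n. Since R commutes with P, m o R (S_n 1_A) = m(S_n f), which exceeds
   m(S_n P f) by at most m(E)/n; absorbing this into c/2 gives
   psi(A) = phi(R 1_A) m(E) and delta = 1 - c / (2 m(E)). *)
Require Import Defs.
From HB Require Import structures.
From mathcomp Require Import all_boot all_order all_algebra.
From mathcomp Require Import all_classical all_reals all_analysis.
From mathcomp Require Import measurable_realfun ring lra.
Import Order.TTheory GRing.Theory Num.Theory.
Local Open Scope classical_set_scope.
Local Open Scope ring_scope.
Local Open Scope ereal_scope.

(** * Integration against a mixture of measures *)

Section mixture.
Context {d d' : measure_display} {X : measurableType d} {Y : measurableType d'}
  {R : realType}.
Variables (nu : {measure set X -> \bar R}) (k : X -> {measure set Y -> \bar R})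
  (mu : {measure set Y -> \bar R}).
Hypothesis mk : forall A, measurable A -> measurable_fun [set: X] (k ^~ A).
Hypothesis mu_mix : forall A, measurable A -> mu A = \int[nu]_x k x A.

Import HBNNSimple.

Let integral_mixture_nnsfun (f : {nnsfun Y >-> R}) :
  \int[mu]_y (f y)%:E = \int[nu]_x \int[k x]_y (f y)%:E.
Proof.
(* A negative [r] has empty preimage under [f], so its term vanishes on both sides. *)
have f0 r : (0 <= r)%R \/ f @^-1` [set r] = set0.
  by case: (leP 0%R r) => r0; [left|right; exact: preimage_nnfun0].
have step (m : {measure set Y -> \bar R}) :
    \int[m]_y (f y)%:E = \sum_(r \in range f) r%:E * m (f @^-1` [set r]).
  by rewrite integralT_nnsfun sintegralE.
rewrite step.
under eq_integral do rewrite step.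
rewrite ge0_integral_fsum//; last 2 first.
- by move=> r; apply: measurable_funeM; exact: mk.
- move=> r x _; have [r0|->] := f0 r; last by rewrite measure0 mule0.
  by rewrite mule_ge0.
apply: eq_fsbigr => r _; rewrite mu_mix//.
have [r0|r0] := f0 r; first by rewrite ge0_integralZl//; exact: mk.
under eq_integral do rewrite r0 measure0.
under [RHS]eq_integral do rewrite r0 measure0 mule0.
by rewrite !integral0 mule0.
Qed.

(** Simple functions increase to [f]; monotone convergence is applied under each [k x] and then
    under [nu]. It serves both for the iterated kernels and for m o R. *)
Lemma integral_mixture (f : Y -> \bar R) :
  (forall y, 0 <= f y) -> measurable_fun [set: Y] f ->
  \int[mu]_y f y = \int[nu]_x \int[k x]_y f y.
Proof.
move=> f0 mf.
pose f_ := nnsfun_approx measurableT mf.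
have mf_ n : measurable_fun [set: Y] (fun y => (f_ n y)%:E).
  exact/measurable_EFinP.
have f_0 n y : 0 <= (f_ n y)%:E by rewrite lee_fin.
have nd_f_ y : {homo (fun n => (f_ n y)%:E) : a b / (a <= b)%N >-> a <= b}.
  by move=> a b ab; rewrite lee_fin; exact/lefP/nd_nnsfun_approx.
have lim_f (m : {measure set Y -> \bar R}) :
    \int[m]_y f y = limn (fun n => \int[m]_y (f_ n y)%:E).
  rewrite -monotone_convergence//; apply: eq_integral => y _.
  by apply/esym/cvg_lim => //; exact: cvg_nnsfun_approx.
rewrite lim_f; under eq_integral do rewrite lim_f.
rewrite monotone_convergence//.
- by under eq_fun do rewrite integral_mixture_nnsfun.
- by move=> n; exact: measurable_fun_integral_kernel.
- by move=> n x _; exact: integral_ge0.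
- by move=> x _ a b ab; apply: ge0_le_integral => // y _; exact: nd_f_.
Qed.

End mixture.

(** * Subtracting a constant under the integral *)

Section integralBcst.
Context {d : measure_display} {T : measurableType d} {R : realType}.
Variables (nu : {measure set T -> \bar R}) (u : T -> \bar R) (c : R).

(* [u] need not be integrable: the identity also holds as [+oo = +oo]. *)
Lemma ge0_integralBcst : nu setT < +oo -> (0 <= c)%R ->
  (forall x, 0 <= u x) -> measurable_fun setT u ->
  \int[nu]_x (u x - c%:E) = \int[nu]_x u x - c%:E * nu setT.
Proof.
move=> nuT c0 u0 mu.
set v := fun x => u x - c%:E.
have mv : measurable_fun setT v by apply: emeasurable_funB.
have finT : c%:E * nu setT \is a fin_num.
  by rewrite fin_numM// ge0_fin_numE.
have cst_int : \int[nu]_x (cst c%:E x) = c%:E * nu setT by rewrite integral_cst.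
(* Since [u] is nonnegative, the negative part of [v] is bounded by [c]; its integral is finite and
   can be cancelled even when that of [u] is infinite. *)
have vn_le x : v^\- x <= c%:E.
  rewrite funenegE/= /v ge_max lee_fin c0 andbT.
  have := u0 x; case: (u x) => [r||]//=; rewrite ?lee_fin; last by rewrite leNye.
  by move=> r0; rewrite opprB lerBlDr lerDl.
have intn_fin : \int[nu]_x v^\- x \is a fin_num.
  rewrite ge0_fin_numE ?integral_ge0//.
  apply: (@le_lt_trans _ _ (c%:E * nu setT)); last by rewrite ltey_eq finT.
  rewrite -cst_int; apply: ge0_le_integral => //.
  exact: measurable_funeneg.
(* Pointwise [u + v^\- = v^\+ + c], with nonnegative terms only, so integration is additive on both
   sides. *)
have key : \int[nu]_x u x + \int[nu]_x v^\- x =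
           \int[nu]_x v^\+ x + c%:E * nu setT.
  rewrite -cst_int -!ge0_integralD//; last 2 first.
    exact: measurable_funepos.
    exact: measurable_funeneg.
  apply: eq_integral => x _.
  have : v x = v^\+ x - v^\- x by rewrite {1}(funeposneg v).
  have nf : v^\- x \is a fin_num.
    by rewrite ge0_fin_numE// (le_lt_trans (vn_le x))// ltry.
  move=> /(congr1 (fun z => z + v^\- x)); rewrite subeK// /v => <-.
  by rewrite addeAC subeK.
rewrite integralE.
have -> : \int[nu]_x u x = \int[nu]_x v^\+ x + c%:E * nu setT - \int[nu]_x v^\- x.
  by rewrite -key addeK.
by rewrite addeAC addeK.
Qed.

End integralBcst.

(** * Iterates of P, their means, and the resolvent R *)

Definition nonneg_measurable {d : measure_display} {T : measurableType d}
    {R : realType} (f : T -> \bar R) :=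
  (forall x, 0 <= f x) /\ measurable_fun [set: T] f.

Section operators.
Context {d : measure_display} {T : measurableType d} {R : realType}.
Variable P : R.-pker T ~> T.
Implicit Types f g : T -> \bar R.

Local Notation pos := nonneg_measurable.

Lemma Pop_pos f : pos f -> pos (Pop P f).
Proof.
move=> [f0 mf]; split; first by move=> x; exact: integral_ge0.
by apply: measurable_fun_integral_kernel => //; exact: measurable_kernel.
Qed.

Lemma Ppow_pos k f : pos f -> pos (Ppow P k f).
Proof. by move=> pf; elim: k => //= k; exact: Pop_pos. Qed.

Lemma PpowSr k f : Ppow P k.+1 f = Ppow P k (Pop P f).
Proof. by elim: k => //= k ->. Qed.

Lemma le_Ppow k f g : pos f -> pos g -> (forall x, f x <= g x) ->
  forall x, Ppow P k f x <= Ppow P k g x.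
Proof.
move=> pf pg fg; elim: k => //= k ih x.
have [? ?] := Ppow_pos k f pf; have [? ?] := Ppow_pos k g pg.
exact: ge0_le_integral.
Qed.

Lemma Pop_cst (c : \bar R) : Pop P (cst c) = cst c.
Proof.
by apply/funext => x; rewrite /Pop integral_cst// prob_kernel mule1.
Qed.

Lemma Ppow_cst k (c : \bar R) : Ppow P k (cst c) = cst c.
Proof. by elim: k => //= k ->; exact: Pop_cst. Qed.

Lemma Ppow_Bcst k (c : R) f : (0 <= c)%R -> pos f ->
  Ppow P k (fun x => f x - c%:E) = fun x => Ppow P k f x - c%:E.
Proof.
move=> c0 pf; elim: k => //= k ->; apply/funext => x.
have [? ?] := Ppow_pos k f pf.
rewrite /Pop ge0_integralBcst ?prob_kernel ?mule1//.
by rewrite ltry.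
Qed.

(** The average of [n] copies of [c] is [c]. Positivity of [n] matters: [Smean P 0] is identically
    0. *)
Lemma Smean_Bcst n (c : R) f : (0 < n)%N -> (0 <= c)%R -> pos f ->
  Smean P n (fun x => f x - c%:E) = fun x => Smean P n f x - c%:E.
Proof.
move=> n0 c0 pf; apply/funext => x; rewrite /Smean.
under eq_bigr do rewrite Ppow_Bcst// -EFinN.
rewrite big_split/= sumEFin sumr_const card_ord.
rewrite muleDr ?fin_num_adde_defl// -EFinM; congr (_ + _%:E).
by rewrite -[(- c *+ n)%R]mulr_natl mulKf// pnatr_eq0 -lt0n.
Qed.

(** The iterates as kernels, so that [Ppow P k f x] becomes an integral against a measure. *)
Fixpoint kpow (k : nat) : R.-spker T ~> T :=
  if k is k'.+1 then mkcomp_noparam P (kpow k')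
  else kdirac (@measurable_id _ T setT).

Lemma integral_kpow k f x : pos f -> \int[kpow k x]_y f y = Ppow P k f x.
Proof.
move=> pf; elim: k x => [|k ih] x/=.
  by rewrite integral_dirac ?diracT ?mul1e//; case: pf.
case: (pf) => f0 mf.
rewrite (integral_mixture (P x) (kpow k))//; last exact: measurable_kernel.
by apply: eq_integral => y _; rewrite ih.
Qed.

Let halfpow_ge0 (k : nat) : (0 <= (2 ^+ k.+1)^-1 :> R)%R.
Proof. by rewrite invr_ge0 exprn_ge0. Qed.

Let halfpow (k : nat) : {nonneg R} := NngNum (halfpow_ge0 k).

(** The resolvent as a family of measures: A is sent to R 1_A(x). *)
Definition kres (x : T) : {measure set T -> \bar R} :=
  mseries (fun k => mscale (halfpow k) (kpow k x)) 0.

Lemma integral_kres f x : pos f -> \int[kres x]_y f y = Rres P f x.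
Proof.
move=> pf; case: (pf) => f0 mf.
rewrite /kres ge0_integral_measure_series//; apply: eq_eseriesr => k _.
by rewrite ge0_integral_mscale// integral_kpow.
Qed.

Lemma kresT x : kres x setT = 1.
Proof.
have <- : Rres P (cst 1) x = 1.
  rewrite /Rres; under eq_eseriesr do rewrite Ppow_cst mule1.
  (* The weights 2^-(k+1) sum to 1. *)
  have := @cvg_geometric_series_half R 1 0; rewrite expr0 divr1 => half1.
  apply/cvg_lim => //; apply/fine_cvgP; split.
    by apply: nearW => n; rewrite sumEFin.
  apply: cvg_trans half1; apply: near_eq_cvg; apply: nearW => n /=.
  rewrite sumEFin /series/=; apply: eq_bigr => i _.
  by rewrite div1r addn1 natrX.
by rewrite -integral_kres// integral_cst// mul1e.
Qed.

Lemma measurable_kres A : measurable A -> measurable_fun setT (kres ^~ A).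
Proof.
move=> mA; rewrite /kres/= /mseries.
apply: ge0_emeasurable_sum => // k _.
by apply: measurable_funeM; exact: measurable_kernel.
Qed.

Lemma Rres_pos f : pos f -> pos (Rres P f).
Proof.
move=> pf; have [f0 mf] := pf.
have -> : Rres P f = fun x => \int[kres x]_y f y.
  by apply/funext => x; rewrite integral_kres.
split; first by move=> x; exact: integral_ge0.
by apply: measurable_fun_integral_kernel => //; exact: measurable_kres.
Qed.

Lemma Rres_le1 f x : pos f -> (forall y, f y <= 1) -> Rres P f x <= 1.
Proof.
move=> pf f1; have [f0 mf] := pf.
rewrite -integral_kres// -(kresT x) -[leRHS]mul1e -integral_cst//.
exact: ge0_le_integral.
Qed.

(** P passes through the nonnegative series by monotone convergence, and the k-th term on either
    side is 2^-(k+1) P^(k+1) f. *)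
Lemma Rres_Pop f : pos f -> Rres P (Pop P f) = Pop P (Rres P f).
Proof.
move=> pf; apply/funext => x; rewrite /Rres/= /Pop integral_nneseries//; last 2 first.
- by move=> k; apply: measurable_funeM; apply: (Ppow_pos k f pf).2.
- move=> k y _; rewrite mule_ge0 ?lee_fin ?halfpow_ge0//.
  exact: (Ppow_pos k f pf).1.
apply: eq_eseriesr => k _; have [? ?] := Ppow_pos k f pf.
rewrite ge0_integralZl ?lee_fin ?halfpow_ge0//.
by rewrite -/(Pop P f) -PpowSr.
Qed.

Lemma Rres_Ppow k f : pos f -> Rres P (Ppow P k f) = Ppow P k (Rres P f).
Proof.
move=> pf; elim: k => //= k <-; rewrite Rres_Pop//; exact: Ppow_pos.
Qed.

Lemma Smean_pos n f : pos f -> pos (Smean P n f).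
Proof.
move=> pf; split.
  move=> x; rewrite mule_ge0 ?lee_fin ?invr_ge0//.
  by apply: sume_ge0 => k _; exact: (Ppow_pos k f pf).1.
apply: measurable_funeM.
by apply: emeasurable_sum => k _; exact: (Ppow_pos k f pf).2.
Qed.

Lemma ge0_integral_Smean (m : {measure set T -> \bar R}) n f : pos f ->
  \int[m]_x Smean P n f x = (n%:R^-1)%:E * \sum_(k < n) \int[m]_x Ppow P k f x.
Proof.
move=> pf; have mP k := (Ppow_pos k f pf).2; have P0 k := (Ppow_pos k f pf).1.
rewrite /Smean ge0_integralZl ?lee_fin ?invr_ge0 ?ge0_integral_sum//.
  exact: emeasurable_sum.
by move=> x _; exact: sume_ge0.
Qed.

(** * The measure m o R and the estimates on means *)

Lemma ind_pos A : measurable A -> pos (@ind d T R A).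
Proof.
by move=> mA; split; [move=> x; rewrite lee_fin|exact/measurable_EFinP].
Qed.

Lemma mR_kres (m : {measure set T -> \bar R}) A : measurable A ->
  mR P m A = \int[m]_x kres x A.
Proof.
move=> mA; apply: eq_integral => x _.
by rewrite -integral_kres; [rewrite integral_indic// setIT|exact: ind_pos].
Qed.

Lemma mRT (m : {measure set T -> \bar R}) : mR P m setT = m setT.
Proof.
by rewrite mR_kres//; under eq_integral do rewrite kresT; rewrite integral_cst// mul1e.
Qed.

(** m o R is the mixture of the measures [kres x] over [m]. *)
Lemma integral_mR (m mu : {measure set T -> \bar R}) f :
  (forall A, measurable A -> mu A = mR P m A) -> pos f ->
  \int[mu]_x f x = \int[m]_x Rres P f x.
Proof.
move=> muE pf; case: (pf) => f0 mf.
rewrite (integral_mixture m kres)//.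
- by apply: eq_integral => x _; rewrite integral_kres.
- exact: measurable_kres.
- by move=> A mA; rewrite muE// mR_kres.
Qed.

Lemma Rres_B1plus A : measurable A -> B1plus (Rres P (@ind d T R A)).
Proof.
move=> mA; have pA := ind_pos _ mA; have [R0 mR] := Rres_pos _ pA.
split=> // x; rewrite R0 Rres_le1// => y.
by rewrite /ind indicE lee_fin lern1 leq_b1.
Qed.

(** The two sums of integrals share all terms but the first and the last: the first is at most m(E),
    and the last, with P^n f, is nonnegative. *)
Lemma le_integral_Smean_Pop (m : {finite_measure set T -> \bar R}) n
    (f : T -> \bar R) : (0 < n)%N -> pos f -> (forall x, f x <= 1) ->
  \int[m]_x Smean P n f x <=
  (n%:R^-1)%:E * m setT + \int[m]_x Smean P n (Pop P f) x.
Proof.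
move=> n0 pf f1; rewrite !ge0_integral_Smean//; last exact: Pop_pos.
have b0 k : 0 <= \int[m]_x Ppow P k f x.
  by apply: integral_ge0 => x _; exact: (Ppow_pos k f pf).1.
have b00 : \int[m]_x Ppow P 0 f x <= m setT.
  rewrite -[leRHS]mul1e -integral_cst//; have [? ?] := pf.
  exact: ge0_le_integral.
rewrite -ge0_muleDr ?measure_ge0//; last by apply: sume_ge0 => k _; rewrite -PpowSr b0.
rewrite lee_wpmul2l ?lee_fin ?invr_ge0//.
under [in leRHS]eq_bigr do rewrite -PpowSr.
apply: (@le_trans _ _ (\sum_(k < n.+1) \int[m]_x Ppow P k f x)).
  by rewrite big_ord_recr/= leeDl.
by rewrite big_ord_recl; apply: leeD.
Qed.

Lemma le_integral_Smean_drift (m : {finite_measure set T -> \bar R}) n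
    (g : T -> R) (a c : R) (f : T -> \bar R) : (0 < n)%N -> (0 <= a)%R ->
  measurable_fun [set: T] g -> (forall x, (-1 <= g x)%R) ->
  pos f -> (forall x, f x <= (1 + a + g x)%:E) ->
  \int[m]_x Smean P n (fun x => (g x)%:E) x <= c%:E ->
  \int[m]_x Smean P n f x <= c%:E + (1 + a)%:E * m setT.
Proof.
move=> n0 a0 mg g1 pf fg gc.
have a10 : (0 <= 1 + a)%R by rewrite addr_ge0.
(* [u] is nonnegative, so its iterates and their integrals make sense and shift
   by constants even when they are infinite. *)
pose u x := (1 + a + g x)%:E.
have pu : pos u.
  split; first by move=> x; rewrite lee_fin addrAC addr_ge0// -lerBlDl sub0r.
  by apply/measurable_EFinP; exact: measurable_funD.
have gu : (fun x => (g x)%:E) = fun x => u x - (1 + a)%:E.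
  by apply/funext => x; rewrite /u -EFinB addrAC subrr add0r.
have [S0 mS] := Smean_pos n u pu; have [Sf0 mSf] := Smean_pos n f pf.
have mT : m setT < +oo by rewrite ltey_eq fin_num_measure.
have fin : (1 + a)%:E * m setT \is a fin_num by rewrite fin_numM// fin_num_measure.
apply: (@le_trans _ _ (\int[m]_x Smean P n u x)).
  apply: ge0_le_integral => // x _.
  rewrite /Smean lee_wpmul2l ?lee_fin ?invr_ge0//.
  by apply: lee_sum => k _; exact: le_Ppow.
move: gc; rewrite gu Smean_Bcst// ge0_integralBcst//.
by rewrite leeBlDr.
Qed.

End operators.

(** * Mean almost invariance of m o R *)

Theorem theorem3p9 (d : measure_display) (T : measurableType d) (R : realType)
  (P : R.-pker T ~> T)
  (C : set T) (phi : (T -> \bar R) -> R) (gamma : T -> R)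
  (m : {finite_measure set T -> \bar R}) :
  measurable C ->
  (forall f, B1plus f -> (0 <= phi f)%R) ->
  (forall x, (0 <= gamma x)%R) ->
  measurable_fun setT gamma ->
  (* Assumption C (i) *)
  (forall x, C x -> forall f, B1plus f ->
     Pop P f x <= (phi f + gamma x)%:E) ->
  (* Assumption C (ii.1) *)
  (forall eps : R, (0 < eps)%R -> exists delta : R, (0 < delta)%R /\
     forall A, measurable A -> mR P m A < delta%:E ->
       (phi (Rres P (ind A)) < eps)%R) ->
  (* Assumption C (ii.2) *)
  (exists n0 : nat, (0 < n0)%N /\
     ereal_sup [set \int[m]_x Smean P n (fun y => (\1_C y * (gamma y - 1))%:E) x
               | n in [set n | (n0 <= n)%N]] < 0) ->
  (* conclusion: m o R (as a measure) is mean almost invariant *)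
  forall mu : {measure set T -> \bar R},
    (forall A, measurable A -> mu A = mR P m A) ->
    mean_almost_invariant P mu.
Proof.
move=> mC phi0 gamma0 mgamma Ci Cii1 [n0 [n0_gt0 sup_lt0]] mu muE.
pose g x : R := (\1_C x * (gamma x - 1))%R.
have mg : measurable_fun [set: T] g.
  by apply: measurable_funM => //; exact: measurable_funB.
have g_geN1 x : (-1 <= g x)%R.
  rewrite /g indicE; case: (x \in C); rewrite ?mul1r ?mul0r ?lerN10//.
  by rewrite lerBrDr addNr.
have [c c0 gc] : exists2 c : R, (0 < c)%R & forall n, (n0 <= n)%N ->
    \int[m]_x Smean P n (fun x => (g x)%:E) x <= (- c)%:E.
  (* The supremum may be [-oo]; any positive constant then works, and 1 is taken. *)
  have lt0 (s : \bar R) : s < 0 -> exists2 c : R, (0 < c)%R & s <= (- c)%:E.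
    case: s => [r||]//; last by exists 1%R => //; rewrite leNye.
    by rewrite lte_fin => r0; exists (- r)%R; rewrite ?oppr_gt0// opprK.
  have [c c0 sc] := lt0 _ sup_lt0.
  exists c => // n nn0; apply: le_trans sc.
  by apply: ereal_sup_ubound; exists n.
pose M : R := fine (m setT).
have ME : m setT = M%:E by rewrite fineK// fin_num_measure.
(* The drift estimate for f = 0 and a = 0 reads 0 <= -c + m(E). This gives [M] > 0, which allows
   division by [M], and later delta >= 0. *)
have cM : (c <= M)%R.
  have p0 : nonneg_measurable (cst 0 : T -> \bar R) by split.
  have : \int[m]_x Smean P n0 (cst 0) x <= (- c)%:E + (1 + 0)%:E * m setT.
    apply: (le_integral_Smean_drift P m n0 g) => //; last exact: gc.
    by move=> x; rewrite lee_fin addr0 -lerBlDl sub0r.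
  move=> /(le_trans (integral_ge0 _ _)) /=.
  rewrite addr0 mul1e ME -EFinD lee_fin => h.
  by rewrite -subr_ge0 addrC; apply: h => x _; exact: (Smean_pos P n0 _ p0).1.
have M0 : (0 < M)%R := lt_le_trans c0 cM.
have muT : mu setT = M%:E by rewrite muE// mRT.
split; first by rewrite muT ltry.
(* Half of the gain [c] goes into delta; the other half absorbs M/n, which is at most c/2 once n >
   2M/c. The maximum with [n0] keeps the drift bound available. *)
exists (1 - c / (2 * M))%R, (fun A => phi (Rres P (ind A)) * M)%R,
  (maxn n0 (Num.truncn (2 * M / c)).+1).
split; [|split; [|split]].
- rewrite subr_ge0 ltrBlDr ltrDl divr_gt0 ?mulr_gt0// andbT.
  by rewrite ler_pdivrMr ?mulr_gt0// mul1r (le_trans cM)// ler_peMl ?ler1n ?ltW//.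
- by move=> A mA; rewrite mulr_ge0 ?(ltW M0)//; exact/phi0/Rres_B1plus.
- move=> eps eps0; have [|eta [eta0 h]] := Cii1 (eps / M)%R.
    by rewrite divr_gt0.
  exists eta; split=> // A mA; rewrite muE// => /(h _ mA).
  by rewrite ltr_pdivlMr.
move=> A mA n; rewrite geq_max => /andP[nn0 ngt].
have n_gt0 : (0 < n)%N by exact: leq_trans n0_gt0 nn0.
have pA : nonneg_measurable (@ind d T R A) by exact: ind_pos.
set f := Rres P (ind A).
have pf : nonneg_measurable f by exact: Rres_pos.
have Bf : B1plus f by exact: Rres_B1plus.
have f1 x : f x <= 1 by case: Bf => _ /(_ x)/andP[].
(* Integration against m o R inserts R, which commutes with each P^k. *)
have -> : \int[mu]_x Smean P n (ind A) x = \int[m]_x Smean P n f x.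
  rewrite !ge0_integral_Smean//; congr (_ * _); apply: eq_bigr => k _.
  by rewrite (integral_mR P m)//; [rewrite Rres_Ppow|exact: Ppow_pos].
apply: (le_trans (le_integral_Smean_Pop P m n f n_gt0 pf f1)).
(* On C the 1 cancels against [gamma x - 1], leaving the bound of Assumption C(i); off C, [g]
   vanishes and P f <= P 1 = 1. *)
have Pfg x : Pop P f x <= (1 + phi f + g x)%:E.
  rewrite /g indicE; case: (boolP (x \in C)) => [/set_mem Cx|_].
    have -> : (1 + phi f + 1 * (gamma x - 1) = phi f + gamma x)%R by ring.
    exact: Ci.
  rewrite mul0r addr0; apply: (@le_trans _ _ (Pop P (cst 1) x)).
    have [? ?] := pf; exact: ge0_le_integral.
  by rewrite Pop_cst lee_fin lerDl phi0.
have drift : \int[m]_x Smean P n (Pop P f) x <=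
    (- c)%:E + (1 + phi f)%:E * m setT.
  apply: (le_integral_Smean_drift P m n g) => //; last exact: gc.
    exact: phi0.
  exact: Pop_pos.
apply: (le_trans (leeD2l _ drift)); rewrite muT ME -!EFinM -!EFinD lee_fin.
have nM : (n%:R^-1 * M <= c / 2)%R.
  rewrite mulrC ler_pdivrMr ?ltr0n//.
  have : (2 * M / c < n%:R)%R.
    by rewrite (lt_le_trans (truncnS_gt _))// ler_nat.
  by rewrite ltr_pdivrMr// => /ltW h; rewrite mulrAC ler_pdivlMr// mulrC [leRHS]mulrC.
have -> : ((1 - c / (2 * M)) * M = M - c / 2)%R.
  by rewrite mulrBl mul1r invfM mulrA mulrVK ?unitfE ?gt_eqF.
(* What remains is M/n - c + M + phi(f) M <= phi(f) M + M - c/2, which is [nM]. *)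
by rewrite mulrDl mul1r; lra.
Qed.
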